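(* For every fixed integer $d\ge 2$, there are constants $C_d>0$ and $N_d\ge 1$ (depending only on $d$) such that every integer $n\ge N_d$ and every nonempty set $X\subset[n]^d$ satisfy $$\tau(X)\le C_d\, n^{2d/(d+1)}.$$
   Context: For a positive integer $n$, $[n]^d=\{1,\ldots,n\}^d\subset\mathbb{R}^d$ denotes the $d$-dimensional integer grid (a discrete set of $n^d$ points). For a finite set $Y\subset\mathbb{R}^d$, $\operatorname{ext}(Y)$ denotes the set of vertices (extreme points) of the convex hull $\operatorname{conv}(Y)$. Given a finite set $X\subset\mathbb{R}^d$, define $X_0=X$ and recursively $X_i=X_{i-1}\setminus\operatorname{ext}(X_{i-1})$ for $i\ge 1$. The layer number $\tau(X)$ is the smallest $i$ for which $X_i=\varnothing$. *)

(* Defs.v *)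
From HB Require Import structures.
From mathcomp Require Import all_boot all_order all_algebra finmap.
From mathcomp Require Import all_classical all_reals all_analysis.
From mathcomp Require Import ring lra.

Set Implicit Arguments.
Unset Strict Implicit.
Unset Printing Implicit Defensive.

Import Order.TTheory GRing.Theory Num.Theory.

Local Open Scope classical_set_scope.
Local Open Scope ring_scope.

Definition convex_hull (R : realType) (V : lmodType R) (Y : set V) : set V :=
  smallest (@convex_set R V) Y.

Definition extreme_points (R : realType) (V : lmodType R) (K : set V) : set V :=
  [set x | K x /\ forall (y z : V) (t : R), K y -> K z -> 0 < t < 1 ->
                    x = t *: y + (1 - t) *: z -> y = z].

Definition ext (R : realType) (V : lmodType R) (Y : set V) : set V :=
  extreme_points (convex_hull Y).

Definition peel (R : realType) (V : lmodType R) (X : set V) (i : nat) : set V :=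
  iter i (fun Y => Y `\` ext Y) X.

Definition grid (R : realType) (n d : nat) : set 'rV[R]_d :=
  [set x | forall j, exists2 k : nat, (1 <= k <= n)%N & x ord0 j = k%:R].

Arguments grid R n d : clear implicits.

(* A point of largest Euclidean norm is a vertex, so peeling a finite set of
   R^d ends with the empty set and the layer number below is well defined. *)
Section peeling_ends.
Context {R : realType} {d : nat}.
Implicit Types (x y z : 'rV[R]_d) (Y : set 'rV[R]_d).

Let sqn x : R := \sum_j x ord0 j ^+ 2.

Let sqn_ge0 x : 0 <= sqn x.
Proof. by apply: sumr_ge0 => j _; exact: sqr_ge0. Qed.

Let sqn_eq0 x : sqn x = 0 -> x = 0.
Proof.
move=> /eqP; rewrite psumr_eq0; last by move=> j _; exact: sqr_ge0.
move=> /allP x0; apply/rowP => j; rewrite mxE; apply/eqP.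
by rewrite -sqrf_eq0; apply: x0; rewrite mem_index_enum.
Qed.

Let sqn_conv (t : R) x y : sqn (t *: x + (1 - t) *: y) =
  t * sqn x + (1 - t) * sqn y - t * (1 - t) * sqn (x - y).
Proof.
rewrite /sqn !mulr_sumr -sumrN -!big_split /=; apply: eq_bigr => j _.
by rewrite !mxE; ring.
Qed.

Let convex_ball (r : R) : @convex_set R 'rV[R]_d [set x | sqn x <= r].
Proof.
move=> x y t /set_mem /= xr /set_mem /= yr; apply/mem_set.
rewrite /= /conv /= sqn_conv.
have t0 : 0 <= t%:num by [].
have t1 : 0 <= 1 - t%:num by rewrite subr_ge0.
have := sqn_ge0 (x - y); have := mulr_ge0 t0 t1.
nra.
Qed.

Let ext_farthest Y x :
  Y x -> (forall y, Y y -> sqn y <= sqn x) -> ext Y x.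
Proof.
move=> Yx xmax; split; first exact: sub_gen_smallest.
have hull_ball : convex_hull Y `<=` [set y | sqn y <= sqn x].
  by apply: smallest_sub => //; exact: convex_ball.
move=> y z t /hull_ball /= yx /hull_ball /= zx /andP[t0 t1] xE.
have /eqP := sqn_conv t y z; rewrite -xE => /eqP xyz.
apply/subr0_eq/sqn_eq0/le_anti; rewrite sqn_ge0 andbT.
have tt : 0 < t * (1 - t) by rewrite mulr_gt0// subr_gt0.
rewrite -(pmulr_rle0 _ tt); nra.
Qed.

Lemma peel_fset0 (X : {fset 'rV[R]_d}) :
  exists i, `[< peel [set` X] i = set0 >].
Proof.
suff [i Xi] : exists i, peel [set` X] i = set0 by exists i; apply/asboolP.
have [m] := ubnP #|` X|; elim: m X => // m IH X /ltnSE Xm.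
have [->|[x0 Xx0]] := fset_0Vmem X.
  by exists 0%N; rewrite /peel /= set_fset0.
have [x Xx xmax] : exists2 x, x \in X & forall y, y \in X -> sqn y <= sqn x.
  case: (arg_maxP (fun y : X => sqn (val y)) (isT : predT [` Xx0]%fset)).
  move=> x _ xmax; exists (val x); first exact: valP.
  by move=> y Xy; exact: (xmax [` Xy]%fset isT).
pose X' := [fset y in X | ~~ `[< ext [set` X] y >]]%fset.
have X'E : [set` X'] = [set` X] `\` ext [set` X].
  apply/seteqP; split=> y /=; rewrite !inE /=.
    by move=> /andP[yX /asboolPn].
  by move=> [yX /asboolPn yE]; apply/andP.
have [|i Xi] := IH X'.
  apply: leq_trans Xm; apply: fproper_ltn_card.
  rewrite fproperEneq; apply/andP; split.
    apply/eqP => XX'; have : x \in X' by rewrite XX'.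
    by rewrite !inE Xx /= => /asboolP; apply; exact: ext_farthest.
  by apply/fsubsetP => y; rewrite !inE => /andP[].
by exists i.+1; rewrite /peel iterSr -X'E.
Qed.

End peeling_ends.

Definition layer_number (R : realType) (d : nat) (X : {fset 'rV[R]_d}) : nat :=
  ex_minn (peel_fset0 X).

(* Main.v *)
Require Import Defs.
From HB Require Import structures.
From mathcomp Require Import all_boot all_order all_algebra finmap.
From mathcomp Require Import all_classical all_reals all_analysis.
From mathcomp Require Import zify ring lra.

Set Implicit Arguments.
Unset Strict Implicit.
Unset Printing Implicit Defensive.


(** The proof follows the support function f_Y(u) = max over y in Y of the
scalar product of u and y, for u in the box {1..m}^d of integer directions,
while Y runs through the successive sets X_i. It is at most d * m * n, and the
claim is that one peeling step lowers it by at least H for at least half of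
the directions, where H is about n^(1/(d+1)) and m is a large constant times
H^d. Summing over the box, there are at most
O(d m n / H) = O(n H^(d-1)) = O(n^(2d/(d+1))) steps.

Let B be the current set and A the set left after peeling. Some vertex x of B
maximizes u over B, and x is not in A. If f drops by at most H at u, then
some y in A has u.y >= u.x - H, and w = y - x is a nonzero integer vector with
|u.w| <= H. There are two cases.

- Some coordinate has |w_j| >= 2H. As both x and y nearly maximize u, the
  convex function f_B bends sharply at u in direction e_j: its second
  difference f_B(u + e_j) + f_B(u - e_j) - 2 f_B(u) is at least H. On a line
  parallel to e_j the second differences are nonnegative and telescope to a
  difference of slopes, which is at most n because f_B has slopes in [0, n]
  there. So at most d m^(d-1) n / H <= m^d / 4 directions have such a bend
  ([card_kink]).

- All |w_j| are below 2H. If s is the largest |w_j|, a line parallel to e_j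
  contains at most 2H / s + 1 directions u with |u.w| <= H. There are O(s^(d-1))
  vectors w for each s, and the sum over s < 2H is O(H^d m^(d-1)), again at most
  m^d / 4 by the choice of m ([card_short_normal]).

That the maximum of u is attained at a vertex comes from a single observation:
the point of a set farthest from any given centre is a vertex of its hull, and
a centre at -N u with N large makes the farthest point maximize u
([vertex_of_layer]). *)

Import Order.TTheory GRing.Theory Num.Theory.
Local Open Scope nat_scope.
Local Open Scope set_scope.

(** * Counting along the coordinate lines of a box *)

Lemma card_indicator (U : finType) (P : pred U) :
  #|[set u | P u]| = \sum_u (P u : nat).
Proof.
by rewrite -sum1dep_card big_mkcond; apply: eq_bigr => u _; case: (P u).
Qed.

Lemma card_exists_le (I U : finType) (Q : I -> pred U) :
  #|[set u | [exists i, Q i u]]| <= \sum_i #|[set u | Q i u]|.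
Proof.
rewrite card_indicator (eq_bigr _ (fun i _ => card_indicator (Q i))).
rewrite exchange_big; apply: leq_sum => u _.
by case: existsP => // -[i Qi]; rewrite (bigD1 i) //= Qi.
Qed.

Definition set_coord (I K : finType) (u : {ffun I -> K}) j k : {ffun I -> K} :=
  [ffun i => if i == j then k else u i].

(** Averaging over coordinate lines: exchanging the new entry k with the old
entry u j is an involution on the pairs (u, k), so each F u occurs once for
every value of k. *)
Lemma sum_lines (I K : finType) (j : I) (F : {ffun I -> K} -> nat) :
  \sum_u \sum_k F (set_coord u j k) = #|K| * \sum_u F u.
Proof.
pose swap (c : {ffun I -> K} * K) := (set_coord c.1 j c.2, c.1 j).
have swapK : involutive swap.
  case=> u k; rewrite /swap /=; congr pair; last by rewrite ffunE eqxx.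
  by apply/ffunP => i; rewrite !ffunE; case: eqP => // ->.
rewrite pair_bigA /= (reindex_inj (inv_inj swapK)) /=.
transitivity (\sum_(c : {ffun I -> K} * K) F c.1).
  apply: eq_bigr => -[u k] _; congr F.
  by apply/ffunP => i; rewrite !ffunE; case: eqP => // ->.
rewrite -(pair_bigA _ (fun u _ => F u)) /= big_distrr /=.
by apply: eq_bigr => u _; rewrite sum_nat_const.
Qed.

Lemma card_lines_le (I K : finType) (j : I) (P : pred {ffun I -> K}) b c :
  (forall u, #|[set k | P (set_coord u j k)]| * b <= c) ->
  #|[set u | P u]| * #|K| * b <= #|K| ^ #|I| * c.
Proof.
move=> Pc; rewrite card_indicator [X in X * b]mulnC -(sum_lines j).
rewrite big_distrl /= -card_ffun -sum_nat_const; apply: leq_sum => u _.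
by rewrite -(card_indicator (fun k => P (set_coord u j k))).
Qed.

Lemma card_slice (I K : finType) (j : I) (c : K) :
  #|[set u : {ffun I -> K} | u j == c]| = #|K| ^ #|I|.-1.
Proof.
have K_gt0 : 0 < #|K| by apply/card_gt0P; exists c.
have I_gt0 : 0 < #|I| by apply/card_gt0P; exists j.
apply/eqP; rewrite -(eqn_pmul2l K_gt0) -expnS prednK //; apply/eqP.
rewrite card_indicator -(sum_lines j) -card_ffun.
rewrite -sum1_card; apply: eq_bigr => u _.
rewrite (bigD1 c) //= ffunE eqxx eqxx big1 // => k kc.
by rewrite ffunE eqxx (negPf kc).
Qed.

(** Telescoping of second differences, with the two boundary slopes
g m.+1 - g m and g 1 - g 0 moved so that no subtraction occurs. *)
Lemma sum_second_difference (g : nat -> nat) m :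
  \sum_(k < m) (g k.+2 + g k) + g m + g 1 =
  2 * (\sum_(k < m) g k.+1) + g m.+1 + g 0.
Proof.
elim: m => [|m IH]; first by rewrite !big_ord0; lia.
rewrite !big_ord_recr /=.
move: (\sum_(k < m) _) (\sum_(k < m) _) IH => a b IH; lia.
Qed.

(** With k the line coordinate of a direction u and s the coordinate of w along
that line, moving from l to k changes u.w by (k - l) s; so this bounds the
number of directions on a line for which u.w stays in [-H, H]. *)
Lemma card_short_progression m (P : pred 'I_m) s H :
  0 < s -> (forall k l, P k -> P l -> k * s <= l * s + 2 * H) ->
  #|[set k | P k]| * s <= 2 * H + s.
Proof.
move=> s_gt0 Pclose.
have [->|[k0 Pk0]] := set_0Vmem [set k | P k]; first by rewrite cards0.
rewrite inE in Pk0.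
have [l Pl lmin] := arg_minnP (fun k : 'I_m => (k : nat)) Pk0.
pose f (k : 'I_m) : 'I_((2 * H) %/ s).+1 := inord (k - l).
have fE k : P k -> f k = k - l :> nat.
  move=> Pk; rewrite inordK // ltnS leq_divRL //.
  by rewrite mulnBl leq_subLR Pclose.
have f_inj : {in [set k | P k] &, injective f}.
  move=> k k'; rewrite !inE => Pk Pk' /(congr1 (@nat_of_ord _)).
  rewrite !fE // => E; apply: val_inj => /=.
  by have := lmin _ Pk; have := lmin _ Pk'; lia.
have := max_card [in f @: [set k | P k]].
rewrite card_in_imset // card_ord => le_card.
apply: leq_trans (leq_mul le_card (leqnn s)) _.
by rewrite mulSn addnC leq_add2r leq_trunc_div.
Qed.

(** * Directions nearly orthogonal to a short integer vector *)

Section Directions.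
Variables (d m : nat).
Implicit Types (u : {ffun 'I_d -> 'I_m}) (v w : 'I_d -> nat) (j : 'I_d).

(** Directions have entries in 1..m, so that their neighbours in the coordinate
directions still have entries in nat. *)
Definition direction u : 'I_d -> nat := fun i => (u i).+1.

Definition update v j k : 'I_d -> nat := fun i => if i == j then k else v i.

Definition dotn v w := \sum_i v i * w i.

Lemma dotn_update v j k w :
  dotn (update v j k) w = k * w j + \sum_(i | i != j) v i * w i.
Proof.
rewrite /dotn (bigD1 j) //= /update eqxx; congr addn.
by apply: eq_bigr => i /negPf ->.
Qed.

Lemma direction_set_coord u j (k : 'I_m) :
  direction (set_coord u j k) = update (direction u) j k.+1.
Proof.
by apply/funext => i; rewrite /direction /update ffunE; case: eqP.
Qed.

Lemma update_update v j k l : update (update v j k) j l = update v j l.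
Proof. by apply/funext => i; rewrite /update; case: eqP. Qed.

Lemma update_id v j : update v j (v j) = v.
Proof. by apply/funext => i; rewrite /update; case: eqP => // ->. Qed.

(** This is |v.(w - s(1,...,1))| <= H: integer vectors of sup norm at most s are
encoded by adding s to every entry. *)
Definition nearly_orthogonal H s v w :=
  (dotn v w <= s * (\sum_i v i) + H) && (s * (\sum_i v i) <= dotn v w + H).

Lemma card_nearly_orthogonal H s j w : 0 < s -> w j = 2 * s ->
  #|[set u | nearly_orthogonal H s (direction u) w]| * m * s
    <= m ^ d * (2 * H + s).
Proof.
move=> s_gt0 wj.
have := @card_lines_le _ _ j
  (fun u => nearly_orthogonal H s (direction u) w) s (2 * H + s).
rewrite !card_ord; apply => u; apply: card_short_progression => // k l.
rewrite !direction_set_coord /nearly_orthogonal !dotn_update wj.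
have sumE q : \sum_i update (direction u) j q i =
    q + \sum_(i | i != j) direction u i.
  rewrite (bigD1 j) //= /update eqxx; congr addn.
  by apply: eq_bigr => i /negPf ->.
rewrite !sumE; set b := \sum_(i | _) _; set c := \sum_(i | _) _.
move=> /andP[] + + /andP[].
have twice q : q.+1 * (2 * s) = 2 * (q * s) + 2 * s by ring.
by rewrite !twice !mulnDr !mulnS ![s * _]mulnC; lia.
Qed.

(** The vectors encoded by a have sup norm s, attained with positive sign at j;
the sign is no restriction, since w and -w are orthogonal to the same
directions. *)
Definition short_normal_at H s j u :=
  [exists a : {ffun 'I_d -> 'I_(2 * s).+1}, (a j == ord_max) &&
     nearly_orthogonal H s (direction u) (fun i => a i)].

Definition short_normal H u :=
  [exists j : 'I_d, exists s : 'I_(2 * H), (0 < s) &&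
    short_normal_at H s j u].

(** Fixing the entry a j leaves (2 s + 1)^(d-1) vectors, and each of them
accounts for at most a fraction (2 H + s) / (m s) of the box. The factor 1/s
is what keeps the sum over s of order H^d, without a logarithm. *)
Lemma card_short_normal_at H (s : nat) j : 0 < s <= 2 * H -> 2 <= d ->
  #|[set u | short_normal_at H s j u]| * m
    <= 3 ^ d * (2 * H) ^ d.-1 * 2 * m ^ d.
Proof.
move=> /andP[s_gt0 sH] d2.
rewrite -(leq_pmul2r s_gt0).
pose Q (a : {ffun 'I_d -> 'I_(2 * s).+1}) u :=
  (a j == ord_max) && nearly_orthogonal H s (direction u) (fun i => a i).
rewrite -mulnA.
apply: leq_trans (leq_mul (card_exists_le Q) (leqnn (m * s))) _.
rewrite big_distrl /=.
have Qle a : #|[set u | Q a u]| * (m * s)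
    <= (a j == ord_max) * (m ^ d * (2 * H + s)).
  rewrite /Q; case: eqP => aj /=; last first.
    by rewrite mul0n eq_card0 // => u; rewrite !inE.
  by rewrite mul1n mulnA (card_nearly_orthogonal _ (j := j)) // aj.
apply: leq_trans (leq_sum _ (fun a _ => Qle a)) _.
rewrite -big_distrl /=.
have -> : \sum_(a : {ffun 'I_d -> 'I_(2 * s).+1}) ((a j == ord_max) : nat)
    = (2 * s).+1 ^ d.-1.
  rewrite -(card_indicator
    (fun a : {ffun 'I_d -> 'I_(2 * s).+1} => a j == ord_max)).
  by rewrite card_slice !card_ord.
case: d d2 => [|[|e]] // _ /=.
have q_le : (2 * s).+1 ^ e.+1 <= 3 ^ e.+1 * s ^ e.+1.
  by rewrite -expnMn leq_exp2r //; lia.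
have s_le : s ^ e <= (2 * H) ^ e by case: e {q_le} => // e; rewrite leq_exp2r.
have sH2 : 2 * H + s <= 2 * (2 * H) by lia.
apply: leq_trans (leq_mul q_le (leq_mul (leqnn _) sH2)) _.
apply: (@leq_trans
  (3 ^ e.+1 * (s * (2 * H) ^ e) * (m ^ e.+2 * (2 * (2 * H))))).
  by rewrite [s ^ _]expnS leq_mul2r leq_mul2l leq_mul2l s_le !orbT.
rewrite [3 ^ e.+2]expnS [(2 * H) ^ e.+1]expnS.
move: (3 ^ _) (_ ^ e) (m ^ _) => x y z.
have -> : x * (s * y) * (z * (2 * (2 * H))) = x * y * z * H * s * 4 by ring.
have -> : 3 * x * (2 * H * y) * 2 * z * s = x * y * z * H * s * 12 by ring.
by rewrite leq_mul2l orbT.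
Qed.

Lemma card_short_normal H : 2 <= d ->
  #|[set u | short_normal H u]| * m <= d * 6 ^ d * 2 * H ^ d * m ^ d.
Proof.
move=> d2; pose c := 3 ^ d * (2 * H) ^ d.-1 * 2 * m ^ d.
have le_c j (s : 'I_(2 * H)) : #|[set u | (0 < s) &&
    short_normal_at H s j u]| * m <= c.
  case: (posnP s) => [_|s_gt0] /=; last first.
    by apply: card_short_normal_at => //; rewrite s_gt0 ltnW.
  by rewrite eq_card0 // => u; rewrite !inE.
have -> : d * 6 ^ d * 2 * H ^ d * m ^ d = \sum_(j < d) \sum_(s < 2 * H) c.
  rewrite !sum_nat_const !card_ord /c -[6]/(3 * 2) expnMn.
  case: d d2 => // e _ /=; rewrite [_ ^ e.+1 in RHS]expnS.
  rewrite expnMn ![_ ^ e.+1]expnS; ring.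
have bound_j j : #|[set u | [exists s : 'I_(2 * H), (0 < s) &&
    short_normal_at H s j u]]| * m <= \sum_(s < 2 * H) c.
  apply: leq_trans (leq_mul (card_exists_le _) (leqnn m)) _.
  rewrite big_distrl /=.
  by apply: leq_sum => s _; apply: le_c.
apply: leq_trans (leq_mul (card_exists_le _) (leqnn m)) _.
rewrite big_distrl /=.
by apply: leq_sum => j _; apply: bound_j.
Qed.

End Directions.

(** * Support functions and their second differences *)

Section Support.
Context (d n : nat) (T : finType) (p : T -> 'I_d -> nat).
Context (p_le : forall x i, p x i <= n).
Context (p_inj : forall x y, p x =1 p y -> x = y).
Implicit Types (A B : {set T}) (x y : T) (v : 'I_d -> nat) (j : 'I_d).

Definition support A v := \max_(x in A) dotn v (p x).

Lemma support_ge A v x : x \in A -> dotn v (p x) <= support A v.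
Proof. exact: leq_bigmax_cond. Qed.

Lemma support_attained A v :
  A != finset.set0 -> exists2 x, x \in A & support A v = dotn v (p x).
Proof.
move=> /set0Pn/card_gt0P A_gt0.
by have [x Ax fE] := eq_bigmax_cond (fun x => dotn v (p x)) A_gt0; exists x.
Qed.

Lemma support_update_mono A v j k :
  support A (update v j k) <= support A (update v j k.+1).
Proof.
apply/bigmax_leqP => x Ax; apply: leq_trans (support_ge _ Ax).
by rewrite !dotn_update mulSn -addnA leq_addl.
Qed.

Lemma support_update_lip A v j k :
  support A (update v j k.+1) <= support A (update v j k) + n.
Proof.
apply/bigmax_leqP => x Ax; have := support_ge (update v j k) Ax.
by have := p_le x j; rewrite !dotn_update mulSn; lia.
Qed.

Lemma support_update_convex A v j k :
  2 * support A (update v j k.+1) <=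
  support A (update v j k.+2) + support A (update v j k).
Proof.
have [->|A0] := eqVneq A finset.set0; first by rewrite /support !big_set0.
have [x Ax ->] := support_attained (update v j k.+1) A0.
have := support_ge (update v j k) Ax; have := support_ge (update v j k.+2) Ax.
by rewrite !dotn_update !mulSn; lia.
Qed.

Section Box.
Context (m : nat).
Implicit Type u : {ffun 'I_d -> 'I_m}.

Definition kink H A j u :=
  2 * support A (direction u) + H <=
  support A (update (direction u) j (u j).+2) +
  support A (update (direction u) j (u j)).

(** Averaging over the lines parallel to e_j, the second differences on each
line sum to at most n by telescoping, and all are nonnegative by convexity;
hence a line has at most n / H kinks. *)
Lemma card_kink H A j : #|[set u | kink H A j u]| * H * m <= n * m ^ d.
Proof.
pose f u := support A (direction u).
pose g u := support A (update (direction u) j (u j).+2) +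
            support A (update (direction u) j (u j)).
have fg u : 2 * f u + (kink H A j u) * H <= g u.
  case kink_u: (kink H A j u); first by rewrite mul1n.
  rewrite mul0n addn0 /f -{1}(update_id (direction u) j).
  exact: support_update_convex.
have sum_fg : 2 * (\sum_u f u) + #|[set u | kink H A j u]| * H <= \sum_u g u.
  rewrite card_indicator big_distrl big_distrr -big_split /=.
  by apply: leq_sum => u _; exact: fg.
have sum_g : m * (\sum_u g u) <= 2 * (m * (\sum_u f u)) + m ^ d * n.
  have mE : m = #|'I_m| by rewrite card_ord.
  have mdE : m ^ d = #|{ffun 'I_d -> 'I_m}| by rewrite card_ffun !card_ord.
  rewrite mdE [X in X * (\sum_u g u)]mE [X in X * (\sum_u f u)]mE.
  rewrite -!(sum_lines j) big_distrr -sum_nat_const -big_split /=.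
  apply: leq_sum => u _.
  pose s k := support A (update (direction u) j k).
  have -> : \sum_k g (set_coord u j k) = \sum_(k < m) (s k.+2 + s k).
    apply: eq_bigr => k _.
    by rewrite /g direction_set_coord !update_update ffunE eqxx.
  have -> : \sum_k f (set_coord u j k) = \sum_(k < m) s k.+1.
    by apply: eq_bigr => k _; rewrite /f direction_set_coord.
  have := sum_second_difference s m.
  have := support_update_lip A (direction u) j m.
  have := support_update_mono A (direction u) j 0.
  rewrite -/(s _) -/(s _) -/(s _) -/(s _).
  move: (\sum_(k < m) _) (\sum_(k < m) _) => a b; lia.
move: sum_fg sum_g; move: (\sum_u f u) (\sum_u g u) => a b ab.
rewrite -(leq_pmul2l (ltn0Sn 0)) => ?.
have := leq_mul (leqnn m) ab; nia.
Qed.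

Definition slow H A B u :=
  [exists y in A, support B (direction u) <= dotn (direction u) (p y) + H].

(** The maximizer x over B and the point y of A that nearly maximizes u are
distinct, as x is peeled. If |x_j - y_j| >= 2 H, then moving u by one unit in
the direction of +e_j or -e_j favours y over x by 2 H, of which at most H is
lost at u itself: a kink. Otherwise y - x is the short vector. *)
Lemma slow_kink_or_short_normal H A B u x : 0 < H ->
  A \subset B -> x \in B :\: A ->
  support B (direction u) = dotn (direction u) (p x) ->
  slow H A B u -> [exists j, kink H B j u] || short_normal H u.
Proof.
move=> H_gt0 AB; rewrite inE => /andP[xA xB] fE /existsP[y /andP[yA le_y]].
have yB := fintype.subsetP AB _ yA.
case: existsP => //= no_kink.
(* Compare x and y as candidates for the maximum at both neighbours of u. *)
have close j : p x j < p y j + 2 * H /\ p y j < p x j + 2 * H.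
  have := support_ge (update (direction u) j (u j).+2) xB.
  have := support_ge (update (direction u) j (u j).+2) yB.
  have := support_ge (update (direction u) j (u j)) xB.
  have := support_ge (update (direction u) j (u j)) yB.
  have /negP := fun h => no_kink (ex_intro _ j h).
  rewrite /kink -ltnNge; move: fE le_y.
  have dotE z := dotn_update (direction u) j (u j).+1 (p z).
  rewrite (update_id (direction u) j) in dotE.
  rewrite !dotE !dotn_update !mulSn; lia.
have [j0 j0_neq] : exists j, p x j != p y j.
  apply/existsP; apply: contraNT xA; rewrite negb_exists => /forallP h.
  by rewrite (@p_inj x y) // => j; apply/eqP; have := h j; rewrite negbK.
pose gap j := maxn (p x j - p y j) (p y j - p x j).
have [j _ jmax] := arg_maxnP gap (isT : predT j0).
have s_gt0 : 0 < gap j.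
  by have := jmax j0 isT; move/eqP: j0_neq; rewrite /gap; lia.
have s_lt : gap j < 2 * H by have := close j; rewrite /gap; lia.
apply/existsP; exists j; apply/existsP; exists (Ordinal s_lt).
rewrite s_gt0 /=.
have le_dot : dotn (direction u) (p y) <= dotn (direction u) (p x).
  by rewrite -fE support_ge.
rewrite fE in le_y.
(* The encoding needs a positive entry at j, so the roles of x and y depend on
   the sign of the entry of largest absolute value. *)
suff near z w : z j + gap j = w j -> (forall i, w i <= z i + gap j) ->
    (forall i, z i <= w i + gap j) ->
    dotn (direction u) z <= dotn (direction u) w + H ->
    dotn (direction u) w <= dotn (direction u) z + H ->
    short_normal_at H (gap j) j u.
  have le_gap i : p x i <= p y i + gap j /\ p y i <= p x i + gap j.
    by have := jmax i isT; rewrite /gap; lia.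
  have [xy|yx] := leqP (p x j) (p y j).
    by apply: (near (p x) (p y)) => [|i|i||]; rewrite ?/gap; try lia;
      have := le_gap i; rewrite /gap; lia.
  by apply: (near (p y) (p x)) => [|i|i||]; rewrite ?/gap; try lia;
    have := le_gap i; rewrite /gap; lia.
move=> zwj wz zw dzw dwz.
have [a aE] : exists a : {ffun 'I_d -> 'I_(2 * gap j).+1},
    forall i, a i + z i = w i + gap j.
  exists [ffun i => inord (w i + gap j - z i)] => i.
  by rewrite ffunE inordK; have := wz i; have := zw i; lia.
apply/existsP; exists a; apply/andP; split.
  by apply/eqP/val_inj => /=; have := aE j; lia.
have dotE : dotn (direction u) (fun i => a i) + dotn (direction u) z =
    dotn (direction u) w + gap j * \sum_i direction u i.
  rewrite /dotn big_distrr -!big_split /=; apply: eq_bigr => i _.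
  by rewrite -mulnDr aE mulnDr [gap j * _]mulnC.
by rewrite /nearly_orthogonal; lia.
Qed.

(** The value of m makes the bound of [card_short_normal] equal to m^d / 4, and
with n <= H^(d+1) it also brings the d lots of n m^(d-1) / H kinks below
m^d / 4. *)
Lemma card_slow H A B : 2 <= d -> 0 < H -> n <= H ^ d.+1 ->
  m = d * 6 ^ d * 8 * H ^ d ->
  A \subset B ->
  (forall v, exists2 x, x \in B :\: A & support B v = dotn v (p x)) ->
  2 * #|[set u | slow H A B u]| <= m ^ d.
Proof.
move=> d2 H_gt0 nH mE AB Bmax.
have m_gt0 : 0 < m by rewrite mE !muln_gt0 !expn_gt0 H_gt0 /= !andbT; lia.
have normal_le :
    4 * #|[set u : {ffun 'I_d -> 'I_m} | short_normal H u]| <= m ^ d.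
  rewrite -(leq_pmul2r m_gt0); have := card_short_normal m H d2.
  have : d * 6 ^ d * 2 * H ^ d * 4 = m by rewrite mE; ring.
  move: (d * 6 ^ d * 2 * H ^ d) (m ^ d) => c q mc le_cq.
  rewrite -mulnA; apply: leq_trans (leq_mul (leqnn 4) le_cq) _.
  have -> : 4 * (c * q) = q * (c * 4) by ring.
  by rewrite mc.
have kink_le :
    4 * #|[set u : {ffun 'I_d -> 'I_m} | [exists j, kink H B j u]]| <= m ^ d.
  have Hm_gt0 : 0 < H * m by rewrite muln_gt0 H_gt0.
  rewrite -(leq_pmul2r Hm_gt0) -mulnA.
  apply: leq_trans (_ : 4 * (\sum_(j < d) n * m ^ d) <= _).
    rewrite leq_mul2l /=.
    apply: leq_trans (leq_mul (card_exists_le _) (leqnn _)) _.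
    rewrite big_distrl /=; apply: leq_sum => j _.
    by rewrite mulnA card_kink.
  rewrite sum_nat_const card_ord.
  apply: leq_trans (_ : 4 * (d * (H ^ d.+1 * m ^ d)) <= _).
    by rewrite !leq_mul2l leq_mul2r nH !orbT.
  have -> : 4 * (d * (H ^ d.+1 * m ^ d)) = m ^ d * (H * (d * 4 * H ^ d)).
    by rewrite expnS; ring.
  have m_ge : d * 4 * H ^ d <= m.
    rewrite mE leq_mul // -mulnA leq_mul //.
    have : 0 < 6 ^ d by rewrite expn_gt0.
    by lia.
  by rewrite !leq_mul.
have : #|[set u | slow H A B u]| <=
    #|[set u : {ffun 'I_d -> 'I_m} | [exists j, kink H B j u]]
      :|: [set u | short_normal H u]|.
  apply: subset_leq_card; apply/fintype.subsetP => u; rewrite !inE.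
  have [x xBA fE] := Bmax (direction u).
  exact: slow_kink_or_short_normal xBA fE.
move=> /leq_trans/(_ (leq_card_setU _ _)).
by move: normal_le kink_le; do 3 move: #|_|; lia.
Qed.

Lemma support_drop H A B : 2 <= d -> 0 < H -> n <= H ^ d.+1 ->
  m = d * 6 ^ d * 8 * H ^ d ->
  A != finset.set0 -> A \subset B ->
  (forall v, exists2 x, x \in B :\: A & support B v = dotn v (p x)) ->
  2 * (\sum_(u : {ffun 'I_d -> 'I_m}) support A (direction u)) + m ^ d * H <=
  2 * (\sum_(u : {ffun 'I_d -> 'I_m}) support B (direction u)).
Proof.
move=> d2 H_gt0 nH mE A0 AB Bmax.
have slow_le := card_slow d2 H_gt0 nH mE AB Bmax.
have drop (u : {ffun 'I_d -> 'I_m}) : support A (direction u) + H <=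
    support B (direction u) + (slow H A B u) * H.
  have [y yA ->] := support_attained (direction u) A0.
  case slow_u : (slow H A B u).
    by rewrite mul1n leq_add2r support_ge // (fintype.subsetP AB).
  move/negbT: slow_u; rewrite negb_exists => /forallP/(_ y).
  by rewrite yA /= -ltnNge mul0n addn0 => /ltnW.
have := leq_sum (index_enum _) (fun u (_ : true) => drop u).
rewrite !big_split /= sum_nat_const card_ffun !card_ord -big_distrl /=.
rewrite -card_indicator.
move: (\sum_u _) (\sum_u _) #|_| (m ^ d) slow_le => a b c q; nia.
Qed.

End Box.
End Support.

(** * The number of peeling steps *)

Lemma dotn_le d (v w : 'I_d -> nat) a b :
  (forall i, v i <= a) -> (forall i, w i <= b) -> dotn v w <= d * (a * b).
Proof.
move=> va wb; rewrite -[d in d * _]card_ord -sum_nat_const /dotn.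
by apply: leq_sum => i _; exact: leq_mul.
Qed.

(** The potential is the sum of the support function over the box: it starts
at no more than m^d * (d m n) and loses at least H m^d / 2 in each step. *)
Lemma descent_length d n (T : finType) (p : T -> 'I_d -> nat)
    (Y : nat -> {set T}) H k :
  2 <= d -> 0 < H -> n <= H ^ d.+1 ->
  (forall x i, p x i <= n) -> (forall x y, p x =1 p y -> x = y) ->
  (forall i, i <= k -> Y i != finset.set0) ->
  (forall i, Y i.+1 \subset Y i) ->
  (forall i v, i < k -> exists2 x, x \in Y i :\: Y i.+1 &
     support p (Y i) v = dotn v (p x)) ->
  k <= 16 * d ^ 2 * 6 ^ d * n * H ^ d.-1.
Proof.
move=> d2 H_gt0 nH p_le p_inj Y0 YS Ymax.
pose m := d * 6 ^ d * 8 * H ^ d.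
pose F i := \sum_(u : {ffun 'I_d -> 'I_m}) support p (Y i) (direction u).
have m_gt0 : 0 < m by rewrite !muln_gt0 !expn_gt0 H_gt0 /= !andbT; lia.
have dropF i : i <= k -> 2 * F i + i * (m ^ d * H) <= 2 * F 0.
  elim: i => [|i IH] ik; first by lia.
  have := IH (ltnW ik).
  have := support_drop p_le p_inj d2 H_gt0 nH (erefl m) (Y0 _ ik) (YS i)
    (fun v => Ymax i v ik).
  rewrite -/(F i) -/(F i.+1) mulSn; lia.
have F0 : F 0 <= m ^ d * (d * (m * n)).
  have -> : m ^ d = #|{ffun 'I_d -> 'I_m}| by rewrite card_ffun !card_ord.
  rewrite -sum_nat_const; apply: leq_sum => u _; apply/bigmax_leqP => x _.
  by apply: dotn_le => // i; exact: ltn_ord.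
have md_gt0 : 0 < m ^ d by rewrite expn_gt0 m_gt0.
have : m ^ d * (k * H) <= m ^ d * (2 * d * m * n).
  have -> : m ^ d * (k * H) = k * (m ^ d * H) by ring.
  have -> : m ^ d * (2 * d * m * n) = 2 * (m ^ d * (d * (m * n))) by ring.
  by have := dropF k (leqnn k); lia.
rewrite leq_pmul2l // => kH; rewrite -(leq_pmul2r H_gt0).
apply: leq_trans kH _.
have -> : m = d * 6 ^ d * 8 * (H * H ^ d.-1).
  by rewrite -expnS (prednK (ltnW d2)).
by rewrite eq_leq //; ring.
Qed.

Local Open Scope classical_set_scope.
Local Open Scope ring_scope.

(** * Farthest points are vertices *)

Section Vertices.
Context {R : realType} {d : nat}.
Implicit Types (c x y z : 'rV[R]_d) (Y : set 'rV[R]_d).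

Definition sqdist c x : R := \sum_j (x ord0 j - c ord0 j) ^+ 2.

Lemma sqdist_ge0 c x : 0 <= sqdist c x.
Proof. by apply: sumr_ge0 => j _; exact: sqr_ge0. Qed.

Lemma sqdist_eq0 c x : sqdist c x = 0 -> x = c.
Proof.
move=> /eqP; rewrite psumr_eq0; last by move=> j _; exact: sqr_ge0.
move=> /allP x0; apply/rowP => j; apply/eqP.
by rewrite -subr_eq0 -sqrf_eq0; apply: x0; rewrite mem_index_enum.
Qed.

(** Strict convexity of the squared distance, in quantitative form. *)
Lemma sqdist_conv c (t : R) x y : sqdist c (t *: x + (1 - t) *: y) =
  t * sqdist c x + (1 - t) * sqdist c y - t * (1 - t) * sqdist y x.
Proof.
rewrite /sqdist !mulr_sumr -sumrN -!big_split /=; apply: eq_bigr => j _.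
by rewrite !mxE; ring.
Qed.

Lemma convex_closed_ball c (r : R) :
  @convex_set R 'rV[R]_d [set x | sqdist c x <= r].
Proof.
move=> x y t /set_mem /= xr /set_mem /= yr; apply/mem_set.
rewrite /= /conv /= sqdist_conv.
have t0 : 0 <= t%:num by [].
have t1 : 0 <= 1 - t%:num by rewrite subr_ge0.
have := sqdist_ge0 y x; have := mulr_ge0 t0 t1.
nra.
Qed.

(** The hull stays in the ball around c through x, and the sphere bounding that
ball contains no segment. *)
Lemma ext_farthest c Y x :
  Y x -> (forall y, Y y -> sqdist c y <= sqdist c x) -> ext Y x.
Proof.
move=> Yx xmax; split; first exact: sub_gen_smallest.
have hull_ball : convex_hull Y `<=` [set y | sqdist c y <= sqdist c x].
  by apply: smallest_sub => //; exact: convex_closed_ball.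
move=> y z t /hull_ball /= yx /hull_ball /= zx /andP[t0 t1] xE.
have /eqP := sqdist_conv c t y z; rewrite -xE => /eqP xyz.
apply/sqdist_eq0/le_anti; rewrite sqdist_ge0 andbT.
have tt : 0 < t * (1 - t) by rewrite mulr_gt0// subr_gt0.
have : t * (1 - t) * sqdist z y <= 0 by nra.
by rewrite pmulr_rle0.
Qed.

End Vertices.

(** * Peeling subsets of the grid *)

Section Peeling.
Context {R : realType} {d n : nat} (X : {fset 'rV[R]_d}).
Context (X_grid : [set` X] `<=` grid R n d).

Definition coord (x : X) (j : 'I_d) : nat := Num.truncn (val x ord0 j).

Lemma coordE x j : (coord x j)%:R = val x ord0 j.
Proof. by have [k _ xE] := X_grid (valP x) j; rewrite /coord xE natrK. Qed.

Lemma coord_le x j : (coord x j <= n)%N.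
Proof.
by have [k /andP[_ kn] xE] := X_grid (valP x) j; rewrite /coord xE natrK.
Qed.

Lemma coord_inj x y : coord x =1 coord y -> x = y.
Proof.
by move=> xy; apply/val_inj/rowP => j; rewrite -[LHS]coordE -[RHS]coordE xy.
Qed.

(** What is left of X after i rounds, as a set over the finite type of the
points of X, on which the combinatorial lemmas apply. *)
Definition layer i : {set X} :=
  finset (fun x : X => `[< peel [set` X] i (val x) >]).

Lemma mem_layer i x : (x \in layer i) = `[< peel [set` X] i (val x) >].
Proof. by rewrite inE. Qed.

Lemma layerS i : layer i.+1 \subset layer i.
Proof.
apply/fintype.subsetP => x; rewrite !mem_layer => /asboolP[xi _]; exact/asboolP.
Qed.

Lemma peel_layer i z :
  peel [set` X] i z -> exists2 x, x \in layer i & val x = z.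
Proof.
move=> zi; have zX : z \in X by elim: i zi => // i IH [/IH].
by exists [` zX]%fset; rewrite // mem_layer; apply/asboolP.
Qed.

(** The centre of the farthest-point argument is -N v. The squared distance of y
to it is |y|^2 + 2 N v.y + N^2 |v|^2, and since the values v.y are integers and
|y|^2 <= d n^2 < N, a farthest point maximizes v. *)
Lemma vertex_of_layer i v : layer i != finset.set0 ->
  exists2 x, x \in layer i :\: layer i.+1 &
    support coord (layer i) v = dotn v (coord x).
Proof.
move=> /set0Pn[x0 x0i]; pose N := (d * (n * n)).+1.
pose dist2 x := (\sum_j (coord x j + N * v j) ^ 2)%N.
have [x] := arg_maxnP dist2 x0i.
rewrite -[_ x]/(x \in layer i) => xi xmax.
have dist2E y : dist2 y = (dotn (coord y) (coord y) + 2 * N * dotn v (coord y)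
    + N ^ 2 * dotn v v)%N.
  rewrite /dotn !big_distrr -!big_split /=; apply: eq_bigr => j _; ring.
exists x.
  rewrite finset.in_setD; rewrite xi andbT mem_layer.
  apply/asboolPn => -[_ /=]; apply.
  pose c : 'rV[R]_d := \row_j - (N * v j)%:R.
  apply: (@ext_farthest R d c); first by apply/asboolP; rewrite -mem_layer.
  move=> _ /peel_layer[y yi <-].
  have distE z : sqdist c (val z) = (dist2 z)%:R.
    rewrite /sqdist natr_sum; apply: eq_bigr => j _.
    by rewrite mxE opprK -coordE -natrD natrX.
  by rewrite !distE ler_nat; exact: xmax.
apply/eqP; rewrite eqn_leq support_ge // andbT.
apply/bigmax_leqP => y yi; have := xmax y yi; rewrite !dist2E /geq /=.
have := dotn_le (coord_le x) (coord_le x); rewrite /N; nia.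
Qed.

(** Before the last round the remaining set is nonempty, so all rounds but the
last are counted by [descent_length]. *)
Lemma layer_number_bound H : (2 <= d)%N -> (0 < H)%N -> (n <= H ^ d.+1)%N ->
  (layer_number X <= (16 * d ^ 2 * 6 ^ d * n * H ^ d.-1).+1)%N.
Proof.
move=> d2 H_gt0 nH; rewrite /layer_number.
case: ex_minnP => -[//|k] _ kmin; rewrite ltnS.
have layer0 i : (i <= k)%N -> layer i != finset.set0.
  move=> ik; apply/eqP => li0; have := kmin i; rewrite ltnNge ik => /implyP.
  rewrite implybF => /negP; apply; apply/asboolP; rewrite -subset0 => z.
  by move=> /peel_layer[x]; rewrite li0 inE.
apply: (descent_length d2 H_gt0 nH coord_le coord_inj layer0 layerS) => i v ik.
exact/vertex_of_layer/layer0/ltnW.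
Qed.

End Peeling.

Theorem theorem8 (R : realType) (d : nat) (hd : (2 <= d)%N) :
  exists (C : R) (N : nat), 0 < C /\ (1 <= N)%N /\
    forall (n : nat) (X : {fset 'rV[R]_d}),
      (N <= n)%N -> X != fset0 -> [set` X] `<=` grid R n d ->
      (layer_number X)%:R <= C * n%:R `^ ((2 * d)%:R / (d + 1)%:R).
Proof.
pose K := (16 * d ^ 2 * 6 ^ d * 2 ^ d.-1)%N.
exists K.+1%:R, 1%N; split => //; split => // n X n1 _ X_grid.
have n1R : 1 <= n%:R :> R by rewrite ler1n.
have n0R : 0 <= n%:R :> R by [].
(* H is the least integer above y, hence at most 2 y as y >= 1. *)
pose y : R := n%:R `^ (d.+1)%:R^-1.
have y1 : 1 <= y.
  by rewrite -(powRr0 n%:R) /y ler_powR // invr_ge0.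
have y0 : 0 <= y by apply: le_trans y1.
have yn : y ^+ d.+1 = n%:R.
  by rewrite -powR_mulrn // -powRrM mulVf ?pnatr_eq0 // powRr1.
have expE : n%:R `^ ((2 * d)%:R / (d + 1)%:R) = n%:R * y ^+ d.-1.
  rewrite -[in RHS]yn -exprD -powR_mulrn // -powRrM.
  by congr (_ `^ _); rewrite addn1 mulrC; congr (_ * _%:R); lia.
pose H := (Num.truncn y).+1.
have /andP[Hy yH] := truncn_itv y0.
have nH : (n <= H ^ d.+1)%N.
  by rewrite -(ler_nat R) natrX -yn lerXn2r ?nnegrE // ltW.
have H2y : H%:R <= 2 * y by rewrite /H -natr1; lra.
have := layer_number_bound X_grid hd (ltn0Sn _) nH.
rewrite -(ler_nat R) => /le_trans; apply.
rewrite expE -natr1.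
have ny1 : 1 <= n%:R * y ^+ d.-1 by rewrite mulr_ege1 // exprn_ege1.
have HXy : H%:R ^+ d.-1 <= 2 ^+ d.-1 * y ^+ d.-1.
  by rewrite -exprMn lerXn2r ?nnegrE // mulr_ge0.
have : (16 * d ^ 2 * 6 ^ d * n * H ^ d.-1)%:R <= K%:R * (n%:R * y ^+ d.-1).
  have -> : K%:R * (n%:R * y ^+ d.-1) =
    (16 * d ^ 2 * 6 ^ d * n)%:R * (2 ^+ d.-1 * y ^+ d.-1).
    by rewrite /K !natrM !natrX; ring.
  by rewrite natrM natrX ler_wpM2l.
by rewrite -natr1 mulrDl mul1r => ?; apply: lerD.
Qed.
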